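(* There exist constants $C_1,C_2\in(0,1)$ such that the following holds. Let $G$ be a group with a finite symmetric generating set $S$, let $r>0$, and let $T\subset G$ be a symmetric subset (that is, $T=T^{-1}$) such that $l_S(t)\le r$ for all $t\in T$. Let $V\subset G$ be a finite non-empty subset such that $\#\partial_S V/\#V\le C_1/r$. Then $V$ contains a non-empty subset $V'$ which is $C_2$-satisfactory with respect to $T$. In particular, one can take $C_1=1/24$ and $C_2=1/4$.
   Context: $\#A$ denotes the cardinality of $A$. For a group $G$ with finite symmetric generating set $S$, $d_S$ is the word metric and $l_S(g)=d_S(e,g)$ the word length. For $V\subset G$, the boundary $\partial_S V$ is the set of elements $v\in V$ at word distance one from the complement $G\setminus V$. Given a finite set $T\subset G$ and $V\subset G$, an element $v\in V$ is called $\rho$-good if there exist at least $\rho$ distinct elements $u\in T$ such that $vu\in V$. For a constant $C>0$, a set $V$ is called $C$-satisfactory with respect to $T$ if each $v\in V$ is $C\#T$-good. *)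

(* Defs.v *)
From mathcomp Require Import all_boot all_order all_algebra finmap.
From mathcomp Require Import all_classical all_reals.

Set Implicit Arguments.
Unset Strict Implicit.
Unset Printing Implicit Defensive.

Import Order.TTheory GRing.Theory Num.Theory.

Local Open Scope classical_set_scope.
Local Open Scope ring_scope.

(* Meaningful for finite sets only: fset_set sends infinite sets to fset0. *)
Definition card_set (G : choiceType) (A : set G) : nat := #|` fset_set A|.

Section WordMetric.
Context {G : groupType}.
Implicit Types (S T V : set G) (g h v : G).

Definition symmetric_set S : Prop := forall g, S g -> S (g^-1)%g.

Definition generates S : Prop :=
  forall H : {pred G}, group_closed H ->
    (forall s, S s -> s \in H) -> forall g, g \in H.

Definition word_of_length S g (n : nat) : Prop :=
  exists w : seq G, [/\ size w = n, (forall s, s \in w -> S s)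
                      & \big[*%g/1%g]_(s <- w) s = g].

(* The default value 0 is never used when S is symmetric and generates G. *)
Definition word_length S g : nat :=
  if pselect (exists n, `[< word_of_length S g n >]) is left ex
  then ex_minn ex else 0%N.

(* The left-invariant word metric, since goodness below is stated through
   right translates v * u. *)
Definition word_dist S g h : nat := word_length S (g^-1 * h)%g.

Definition boundary S V : set G :=
  [set v | V v /\ exists2 w, ~ V w & word_dist S v w = 1%N].

Definition good {R : realType} T V (rho : R) v : Prop :=
  V v /\ rho <= (card_set [set u | T u /\ V (v * u)%g])%:R.

Definition satisfactory {R : realType} (C : R) T V : Prop :=
  forall v, V v -> good T V (C * (card_set T)%:R) v.

End WordMetric.

(* T is not assumed finite: it lies in a ball of the word metric. *)
Definition satisfactory_constants {R : realType} (C1 C2 : R) : Prop :=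
  forall (G : groupType) (S : set G),
    finite_set S -> symmetric_set S -> generates S ->
  forall (r : R) (T : set G),
    0 < r -> symmetric_set T ->
    (forall t, T t -> (word_length S t)%:R <= r) ->
  forall V : set G,
    finite_set V -> V !=set0 ->
    (card_set (boundary S V))%:R / (card_set V)%:R <= C1 / r ->
  exists V' : set G, [/\ V' `<=` V, V' !=set0 & satisfactory C2 T V'].

(* Main.v *)
Require Import Defs.
From mathcomp Require Import all_boot all_order all_algebra.
From mathcomp Require Import all_classical all_reals.
From mathcomp Require Import finmap lra.

Import Order.TTheory GRing.Theory Num.Theory.
Local Open Scope ring_scope.

(** Join two points of [V] when they differ by right multiplication by an
    element of [T]; this is an undirected graph because [T] is symmetric, and a
    [C2]-satisfactory set is a subset in which every vertex has at least
    [C2 * #T] neighbours inside the subset. Two facts produce one.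

    Most translates stay in [V]: write [t] in [T] as a word of length at most
    [r] in the generators. If [v] is in [V] but [v * t] is not, the path from
    [v] to [v * t] spelled by the word leaves [V] at some step, from a boundary
    point; the boundary point and the step determine [v]. Hence at most
    [r * #(boundary V) <= C1 * #V] points of [V] are moved out by [t]
    ([count_exits_le_boundary]). Summing over [t], the degrees in the graph add
    up to at least [(1 - C1) * #T * #V].

    A dense graph has a subgraph of large minimum degree: keep deleting a vertex
    of degree less than [rho]. Each deletion lowers the sum of the degrees by
    less than [2 * rho], so if that sum exceeds [2 * rho] times the number of
    vertices, the process must stop before the graph is exhausted
    ([subseq_min_degree]).

    With [rho := C2 * #T] the two fit together as soon as [C1 + 2 * C2 < 1],
    which [1/24] and [1/4] satisfy with room to spare. Finite sets are handled
    as duplicate-free sequences, and cardinalities as counts along them. *)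

Lemma leq_count_inj {X Y : eqType} (f : X -> Y) (p : pred X) (q : pred Y)
    (s : seq X) (t : seq Y) :
  injective f -> uniq s ->
  (forall x, x \in s -> p x -> (f x \in t) && q (f x)) ->
  (count p s <= count q t)%N.
Proof.
move=> f_inj s_uniq fst; rewrite -!size_filter -(size_map f).
apply: uniq_leq_size; first by rewrite map_inj_uniq // filter_uniq.
move=> y /mapP[x]; rewrite mem_filter => /andP[px xs] ->.
by rewrite mem_filter andbC fst.
Qed.

Lemma sum_count_exchange {X Y : Type} (e : X -> Y -> bool) (s : seq X)
    (t : seq Y) :
  (\sum_(x <- s) count (e x) t = \sum_(y <- t) count (e^~ y) s)%N.
Proof.
under eq_bigr => x _ do rewrite -sum1_count big_mkcond.
under [RHS]eq_bigr => y _ do rewrite -sum1_count big_mkcond.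
by rewrite exchange_big.
Qed.

(** Each neighbour [x] of [v] costs twice: once in the degree of [v] itself and
    once in the degree of [x]. Only an inequality holds, since a loop at [v]
    costs once. *)
Lemma sum_degree_rem {X : eqType} (e : rel X) (s : seq X) (v : X) :
  symmetric e -> v \in s ->
  (\sum_(x <- s) count (e x) s
     <= (count (e v) s).*2 + \sum_(x <- rem v s) count (e x) (rem v s))%N.
Proof.
move=> e_sym vs; pose s' := rem v s.
have s_perm : perm_eq s (v :: s') by exact: perm_to_rem.
have countE p : count p s = (p v + count p s')%N by rewrite (permP s_perm).
rewrite (perm_big _ s_perm) big_cons /=.
under eq_bigr => x _ do rewrite countE.
rewrite big_split /= -/s' -addnn addnA leq_add2r leq_add2l.
rewrite countE -sum1_count [X in (_ <= _ + X)%N]big_mkcond /=.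
apply: leq_trans (leq_addl _ _); apply: leq_sum => x _.
by rewrite e_sym; case: (e v x).
Qed.

(** The hypothesis is inherited when a vertex of degree less than [rho] is
    deleted, and it fails for the empty graph. *)
Lemma subseq_min_degree {R : realDomainType} {X : eqType} (e : rel X) (rho : R)
    (s : seq X) :
  symmetric e ->
  2 * rho * (size s)%:R < (\sum_(x <- s) count (e x) s)%N%:R ->
  exists u, [/\ subseq u s, u != [::]
              & forall x, x \in u -> rho <= (count (e x) u)%:R].
Proof.
move=> e_sym; have [n] := ubnP (size s); elim: n s => // n IHn s /ltnSE les dense.
have [s_good|] := boolP (all (fun x => rho <= (count (e x) s)%:R) s).
  exists s; split=> //; last by move=> x /(allP s_good).
  by apply: contraTneq dense => ->; rewrite big_nil mulr0 ltxx.
case/allPn=> v vs; rewrite -ltNge => v_bad.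
have s_pos : (0 < size s)%N by case: (s) vs.
have size_s : (size s)%:R = (size (rem v s))%:R + 1 :> R.
  by rewrite size_rem // natr1 prednK.
have [||u [us u0 ug]] := IHn (rem v s).
- by rewrite size_rem // prednK.
- have := sum_degree_rem e s v e_sym vs.
  by rewrite -(ler_nat R) natrD -addnn natrD; move: dense v_bad; rewrite size_s; lra.
- by exists u; split=> //; apply: subseq_trans us (rem_subseq _ _).
Qed.

(** Any [b] holding wherever a single generator leads out of [V] can serve as
    the boundary. By induction on the word: either its first letter already
    leads out, or it translates [v] injectively to a point of [V] from which the
    remaining word leads out. *)
Lemma count_word_exits {G : groupType} (S : set G) (V : seq G) (b : pred G) :
  uniq V ->
  (forall v s, v \in V -> S s -> (v * s)%g \notin V -> b v) ->
  forall w : seq G, (forall s, s \in w -> S s) ->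
  (count (fun v => (v * \big[*%g/1%g]_(s <- w) s)%g \notin V) V
     <= size w * count b V)%N.
Proof.
move=> V_uniq bP; elim=> [_|s w IHw wS].
  rewrite mul0n leqNgt -has_count; apply/hasPn => v vV.
  by rewrite big_nil mulg1 vV.
have {}IHw := IHw (fun t tw => wS t (mem_behead (s := s :: w) tw)).
pose P v := (v * \big[*%g/1%g]_(t <- w) t)%g \notin V.
apply: (@leq_trans (count b V + count P V)); last by rewrite mulSn leq_add2l.
pose leave v := (v * s)%g \notin V.
apply: (@leq_trans (count leave V + count (fun v => ~~ leave v && P (v * s)%g) V)).
  rewrite -count_predUI; apply: leq_trans (leq_addr _ _).
  apply: sub_count => v; rewrite big_cons mulgA => Pv /=.
  by case: (leave v).
apply: leq_add.
  apply: (leq_count_inj id) => // v vV vsV; rewrite vV /=.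
  by apply: bP vsV => //; apply: wS; rewrite mem_head.
apply: (leq_count_inj (fun v => v * s)%g) => [|//|v vV /andP[]]; first exact: mulIg.
by rewrite negbK => -> ->.
Qed.

(** The elements spelled by words form a subgroup containing [S], hence
    everything: the minimum defining the word length is attained. *)
Lemma word_of_length_word_length {G : groupType} (S : set G) (g : G) :
  symmetric_set S -> generates S -> word_of_length S g (word_length S g).
Proof.
move=> S_sym S_gen.
pose H : {pred G} := [pred h | `[< exists n, word_of_length S h n >]].
have H_closed : group_closed H.
  split; first by apply/asboolP; exists 0%N, [::]; split; rewrite ?big_nil.
  move=> x y /asboolP[_ [u [_ uS <-]]] /asboolP[_ [w [_ wS <-]]].
  apply/asboolP; exists (size (u ++ map (fun s => s^-1)%g (rev w))).
  exists (u ++ map (fun s => s^-1)%g (rev w)); split=> //.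
    move=> s; rewrite mem_cat => /orP[/uS//|/mapP[t]].
    by rewrite mem_rev => /wS St ->; exact: S_sym.
  rewrite big_cat /= big_map; congr (_ * _)%g.
  elim: w {wS} => [|t w IHw]; first by rewrite !big_nil invg1.
  by rewrite rev_cons big_rcons/= IHw big_cons invgM.
have HS s : S s -> s \in H.
  move=> Ss; apply/asboolP; exists 1%N, [:: s]; split=> //.
    by move=> t; rewrite inE => /eqP ->.
  by rewrite big_seq1.
have /asboolP gH := S_gen H H_closed HS g.
rewrite /word_length; case: pselect => [ex|[]].
  by case: ex_minnP => n /asboolP.
by case: gH => n gn; exists n; apply/asboolP.
Qed.

Lemma word_length_generator {G : groupType} (S : set G) (s : G) :
  S s -> s != 1%g -> word_length S s = 1%N.
Proof.
move=> Ss s1.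
have s_word : word_of_length S s 1.
  by exists [:: s]; split; rewrite ?big_seq1// => t; rewrite inE => /eqP ->.
rewrite /word_length; case: pselect => [ex|[]]; last first.
  by exists 1%N; apply/asboolP.
case: ex_minnP => -[|n] /asboolP n_word n_min.
  case: n_word => w [/size0nil -> _]; rewrite big_nil => s1'.
  by rewrite -s1' eqxx in s1.
by have := n_min 1%N (introT (asboolP _) s_word); case: n {n_word n_min}.
Qed.

(** The boundary asks for distance exactly one, so the trivial generator has to
    be excluded; it leads nowhere. *)
Lemma exit_boundary {G : groupType} (S V : set G) (v s : G) :
  V v -> S s -> ~ V (v * s)%g -> boundary S V v.
Proof.
move=> Vv Ss Vvs; split=> //; exists (v * s)%g => //.
rewrite /word_dist mulgA mulVg mul1g; apply: word_length_generator => //.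
by apply: contra_notN Vvs => /eqP ->; rewrite mulg1.
Qed.

Lemma finite_word_of_length {G : groupType} (S : set G) (n : nat) :
  finite_set S -> finite_set [set g | word_of_length S g n]%classic.
Proof.
move=> S_fin; elim: n => [|n IHn].
  apply: sub_finite_set (finite_set1 1%g) => g [w [/size0nil -> _ <-]].
  by rewrite big_nil.
apply: sub_finite_set (finite_image2 (fun s g => s * g)%g S_fin IHn).
move=> g [[|s w] [//= [size_w] wS <-]].
exists s; first by apply: wS; rewrite mem_head.
exists (\big[*%g/1%g]_(t <- w) t); last by rewrite big_cons.
by exists w; split=> // t tw; apply: wS; rewrite inE tw orbT.
Qed.

Lemma finite_word_ball {G : groupType} (S : set G) (m : nat) :
  finite_set S -> symmetric_set S -> generates S ->
  finite_set [set g | (word_length S g <= m)%N]%classic.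
Proof.
move=> S_fin S_sym S_gen.
apply: sub_finite_set (@bigcup_finite _ _ `I_m.+1
  (fun n => [set g | word_of_length S g n])%classic _ _) => //.
  by move=> g gm; exists (word_length S g) => //; exact: word_of_length_word_length.
by move=> n _; exact: finite_word_of_length.
Qed.

Lemma count_exits_le_boundary {G : groupType} (S V : set G) (g : G) :
  symmetric_set S -> generates S -> finite_set V ->
  (count (fun v => (v * g)%g \notin fset_set V) (fset_set V)
     <= word_length S g * card_set (boundary S V))%N.
Proof.
move=> S_sym S_gen V_fin.
have VP u : (u \in fset_set V) <-> V u by rewrite in_fset_set // in_setE.
have [w [<- wS g_def]] := word_of_length_word_length S g S_sym S_gen.
pose b : pred G := fun v => `[< boundary S V v >].
have bP v s : v \in fset_set V -> S s -> (v * s)%g \notin fset_set V -> b v.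
  move=> /VP Vv Ss /negP Vvs; apply/asboolP.
  by apply: exit_boundary Vv Ss _ => /VP.
have := count_word_exits S _ b (fset_uniq _) bP w wS; rewrite g_def.
move=> /leq_trans; apply; rewrite leq_mul2l; apply/orP; right.
rewrite /card_set -[X in (_ <= X)%N]count_predT.
apply: (leq_count_inj id) => // [|v vV /asboolP bv]; first exact: fset_uniq.
rewrite andbT in_fset_set ?in_setE //.
by apply: sub_finite_set V_fin => x [].
Qed.

(** The condition compares [2 * (C2 * #T) * #V], what the deletion argument
    needs, with the degree sum [(1 - C1) * #T * #V] that the boundary estimate
    provides. *)
Lemma satisfactory_constants_small {R : realType} (C1 C2 : R) :
  C1 + 2 * C2 < 1 -> satisfactory_constants C1 C2.
Proof.
move=> C_small G S S_fin S_sym S_gen r T r_gt0 T_sym T_ball V V_fin V_ne V_bdry.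
have T_fin : finite_set T.
  apply: sub_finite_set (finite_word_ball S (Num.trunc r) S_fin S_sym S_gen).
  by move=> t Tt; rewrite /= truncn_ge_nat ?T_ball // ltW.
(* An empty [T] asks for nothing, but would make the strict density bound fail. *)
have [T_null|T_nonnull] := eqVneq (card_set T) 0%N.
  by exists V; split=> // v Vv; split=> //; rewrite T_null mulr0 ler0n.
set Ts : {fset G} := fset_set T; set Vs : {fset G} := fset_set V.
have TsP u : (u \in Ts) <-> T u by rewrite in_fset_set // in_setE.
have VsP u : (u \in Vs) <-> V u by rewrite in_fset_set // in_setE.
have Vs_pos : (0 < card_set V)%N.
  by case: V_ne => v /VsP vVs; rewrite /card_set cardfs_gt0; apply/fset0Pn; exists v.
pose e : rel G := fun v x => (v^-1 * x)%g \in Ts.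
have e_sym : symmetric e.
  have eW v x : e v x -> e x v.
    by move=> /TsP/T_sym; rewrite invgM invgK => /TsP.
  by move=> v x; apply/idP/idP; exact: eW.
have exits u : u \in Ts ->
    (count (fun v => (v * u)%g \notin Vs) Vs)%:R <= C1 * (card_set V)%:R.
  move=> /TsP Tu.
  have := count_exits_le_boundary S V u S_sym S_gen V_fin.
  rewrite -(ler_nat R) => /le_trans; apply; rewrite natrM.
  apply: (@le_trans _ _ (r * (card_set (boundary S V))%:R)).
    by apply: ler_pM; rewrite ?ler0n ?ler_nat //; exact: T_ball.
  move: V_bdry; rewrite ler_pdivrMr ?ltr0n // mulrAC ler_pdivlMr //.
  by rewrite mulrC.
have dense : 2 * (C2 * (card_set T)%:R) * (size Vs)%:R
    < (\sum_(v <- Vs) count (e v) Vs)%N%:R.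
  (* The neighbours of [v] are the points [v * u] of [V] with [u] in [T]. *)
  have translates : (\sum_(u <- Ts) count (fun v => (v * u)%g \in Vs) Vs
      <= \sum_(v <- Vs) count (e v) Vs)%N.
    rewrite -(sum_count_exchange (fun v u => (v * u)%g \in Vs)).
    apply: leq_sum => v _; apply: (leq_count_inj (fun u => v * u)%g).
    - exact: mulgI.
    - exact: fset_uniq.
    - by move=> u uTs ->; rewrite /e mulgA mulVg mul1g.
  have stays u : u \in Ts -> (1 - C1) * (card_set V)%:R
      <= (count (fun v => (v * u)%g \in Vs) Vs)%:R.
    move=> /exits; have := count_predC (fun v => (v * u)%g \in Vs) Vs.
    move=> /(congr1 (fun n => n%:R : R)); rewrite natrD /card_set -/Vs.
    by rewrite /predC /=; lra.
  move: translates; rewrite -(ler_nat R) => /(lt_le_trans _); apply.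
  have : (1 - C1) * (card_set V)%:R * (card_set T)%:R
      <= (\sum_(u <- Ts) count (fun v => (v * u)%g \in Vs) Vs)%N%:R.
    rewrite natr_sum [(1 - C1) * _ * _]mulr_natr /card_set -/Ts.
    rewrite -iter_addr_0 -(count_predT (enum_fset Ts)) -big_const_seq.
    rewrite big_seq_cond [leRHS]big_seq_cond.
    by apply: ler_sum => u /andP[/stays].
  apply: lt_le_trans.
  have VT_pos : 0 < (card_set V)%:R * (card_set T)%:R :> R.
    by rewrite mulr_gt0 ?ltr0n // lt0n.
  by move: VT_pos; rewrite /card_set -/Vs; nra.
have [us [us_sub us_ne us_deg]] := subseq_min_degree e _ _ e_sym dense.
exists [set` us]%classic; split.
- by move=> v /= /(mem_subseq us_sub)/VsP.
- by case: us us_ne {us_sub us_deg} => // v us _; exists v; rewrite /= mem_head.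
move=> v /= v_us; split=> //; apply: le_trans (us_deg _ v_us) _.
rewrite ler_nat /card_set -[X in (_ <= X)%N]count_predT.
apply: (leq_count_inj (fun x => v^-1 * x)%g) => [||x x_us /TsP ex].
- exact: mulgI.
- exact: subseq_uniq us_sub (fset_uniq _).
rewrite andbT in_fset_set ?in_setE /=; first by rewrite mulgA mulgV mul1g.
by apply: sub_finite_set T_fin => y [].
Qed.

Theorem theorem1p1 (R : realType) :
  (exists C1 C2 : R,
     [/\ 0 < C1 < 1, 0 < C2 < 1 & satisfactory_constants C1 C2])
  /\ satisfactory_constants (1 / 24 : R) (1 / 4 : R).
Proof.
have explicit : satisfactory_constants (1 / 24 : R) (1 / 4 : R).
  by apply: satisfactory_constants_small; lra.
by split=> //; exists (1 / 24), (1 / 4); split=> //; apply/andP; split; lra.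
Qed.
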